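(* Let $k$ be a commutative associative unital ring, $\mathfrak a$ a $k$-algebra, $R$ a commutative associative unital $k$-algebra which is flat as a $k$-module, $S$ a commutative $R$-algebra which is faithfully flat over $R$, and $B$ an $R$-algebra which is an $S/R$-form of $A=\mathfrak a\otimes_k R$. Let $\kappa$ be a $k$-bilinear form on $\mathfrak a$ which is $\mathbf{Aut}(\mathfrak a)$-invariant. (a) There exists a unique $R$-bilinear form $\kappa_B$ on $B$ such that $(\kappa_B)_{S'}=\theta^*(\kappa_{S'})$ whenever $S'$ is a faithfully flat commutative $R$-algebra and $\theta\colon B\otimes_R S'\to\mathfrak a\otimes_k S'$ is an isomorphism of $S'$-algebras. Moreover, $\kappa_B$ is $\mathbf{Aut}(B)$-invariant. (b) If $\kappa$ is invariant, then so is $\kappa_B$. (c) If $\mathfrak a$ is finitely presented as a $k$-module and $\kappa$ is nondegenerate (resp. nonsingular), then so is $\kappa_B$.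
   Context: Algebras are modules with a bilinear product, no identities (associativity, unit, etc.) assumed. $B$ is an $S/R$-form of $\mathfrak a\otimes_k R$ means there is an $S$-algebra isomorphism $B\otimes_R S\cong(\mathfrak a\otimes_k R)\otimes_R S\cong \mathfrak a\otimes_k S$. For a commutative ring $R$, an $R$-bilinear form $\kappa$ on an $R$-module $M$ and a morphism of commutative rings $R\to T$, the base change $\kappa_T$ is the unique $T$-bilinear form on $M\otimes_R T$ with $\kappa_T(m_1\otimes t_1,m_2\otimes t_2)=\kappa(m_1,m_2)t_1t_2$. For a linear map $f$ and a form $\lambda$, $f^*(\lambda)(x,y)=\lambda(f(x),f(y))$. A bilinear form $\beta$ on an $R$-algebra $C$ is $\mathbf{Aut}(C)$-invariant if for every commutative $R$-algebra $T$ and every $T$-algebra automorphism $f$ of $C\otimes_R T$ one has $f^*(\beta_T)=\beta_T$. $\beta$ is invariant if $\beta(ab,c)=\beta(a,bc)=\beta(b,ca)$ for all $a,b,c$. An $R$-bilinear form $\beta$ on an $R$-module $M$ is nondegenerate (resp. nonsingular) if the map $M\to\mathrm{Hom}_R(M,R)$, $m\mapsto\beta(m,-)$, is injective (resp. bijective). *)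

(* Defs.v *)
From HB Require Import structures.
From mathcomp Require Import all_boot all_order all_algebra.
Set Implicit Arguments. Unset Strict Implicit. Unset Printing Implicit Defensive.
Import GRing.Theory.
Local Open Scope ring_scope.

Definition slin (K T : pzRingType) (phi : K -> T) (M : lmodType K)
  (P : lmodType T) (f : M -> P) :=
  forall (c : K) (x y : M), f (c *: x + y) = phi c *: f x + f y.

Definition lin (K : pzRingType) (M P : lmodType K) (f : M -> P) :=
  forall (c : K) (x y : M), f (c *: x + y) = c *: f x + f y.

Definition lin_functional (K : pzRingType) (M : lmodType K) (l : M -> K) :=
  forall (c : K) (x y : M), l (c *: x + y) = c * l x + l y.

Definition bilin (K : comPzRingType) (M N P : lmodType K) (t : M -> N -> P) :=
  (forall m, lin (t m)) /\ (forall n, lin (fun m => t m n)).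

(* a (not necessarily associative) algebra structure: a bilinear product *)
Definition bilin_op (K : comPzRingType) (M : lmodType K) (mul : M -> M -> M) :=
  bilin mul.

Definition bilin_form (K : comPzRingType) (M : lmodType K) (b : M -> M -> K) :=
  (forall z, lin_functional (b z)) /\ (forall z, lin_functional (fun x => b x z)).

Definition is_tensor (K : comPzRingType) (M N P : lmodType K) (t : M -> N -> P) :=
  bilin t /\
  forall (Q : lmodType K) (b : M -> N -> Q), bilin b ->
    (exists g : P -> Q, lin g /\ forall m n, g (t m n) = b m n) /\
    (forall g1 g2 : P -> Q, lin g1 -> lin g2 ->
       (forall m n, g1 (t m n) = g2 (t m n)) -> forall p, g1 p = g2 p).

Definition flat (K : comPzRingType) (M : lmodType K) :=
  forall (N1 N2 : lmodType K) (f : N1 -> N2), lin f -> injective f ->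
  forall (P1 P2 : lmodType K) (t1 : M -> N1 -> P1) (t2 : M -> N2 -> P2),
    is_tensor t1 -> is_tensor t2 ->
    forall g : P1 -> P2, lin g -> (forall m n, g (t1 m n) = t2 m (f n)) ->
    injective g.

Definition faithfully_flat (K : comPzRingType) (M : lmodType K) :=
  flat M /\
  forall (N P : lmodType K) (t : M -> N -> P), is_tensor t ->
    (forall p : P, p = 0) -> forall n : N, n = 0.

(* (MT, iota) is the base change M (x)_K T along the ring map phi : K -> T,
   with iota m = m (x) 1; characterized by its universal property *)
Definition is_base_change (K T : pzRingType) (phi : K -> T) (M : lmodType K)
  (MT : lmodType T) (iota : M -> MT) :=
  slin phi iota /\
  forall (P : lmodType T) (f : M -> P), slin phi f ->
    (exists g : MT -> P, lin g /\ forall m, g (iota m) = f m) /\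
    (forall g1 g2 : MT -> P, lin g1 -> lin g2 ->
       (forall m, g1 (iota m) = g2 (iota m)) -> forall x, g1 x = g2 x).

Definition is_alg_base_change (K : pzRingType) (T : comPzRingType) (phi : K -> T)
  (M : lmodType K) (mul : M -> M -> M) (MT : lmodType T) (iota : M -> MT)
  (mulT : MT -> MT -> MT) :=
  is_base_change phi iota /\ bilin_op mulT /\
  forall x y, mulT (iota x) (iota y) = iota (mul x y).

(* base change kappa_T of a form kappa:
   kappa_T (m1 (x) t1, m2 (x) t2) = phi (kappa m1 m2) t1 t2 *)
Definition is_form_base_change (K : pzRingType) (T : comPzRingType) (phi : K -> T)
  (M : lmodType K) (kappa : M -> M -> K) (MT : lmodType T) (iota : M -> MT)
  (kappaT : MT -> MT -> T) :=
  bilin_form kappaT /\ forall x y, kappaT (iota x) (iota y) = phi (kappa x y).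

Definition alg_iso (T : comPzRingType) (M N : lmodType T)
  (mulM : M -> M -> M) (mulN : N -> N -> N) (f : M -> N) :=
  lin f /\ bijective f /\ forall x y, f (mulM x y) = mulN (f x) (f y).

Definition aut_invariant (R : comNzRingType) (C : lmodType R)
  (mulC : C -> C -> C) (beta : C -> C -> R) :=
  forall (T : comAlgType R) (CT : lmodType T) (iota : C -> CT)
    (mulT : CT -> CT -> CT),
  is_alg_base_change (fun r : R => r%:A : T) mulC iota mulT ->
  forall betaT : CT -> CT -> T,
  is_form_base_change (fun r : R => r%:A : T) beta iota betaT ->
  forall f : CT -> CT, alg_iso mulT mulT f ->
  forall x y, betaT (f x) (f y) = betaT x y.

Definition invariant_form (K : comPzRingType) (M : lmodType K)
  (mul : M -> M -> M) (beta : M -> M -> K) :=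
  forall x y z, beta (mul x y) z = beta x (mul y z) /\
                beta x (mul y z) = beta y (mul z x).

Definition nondegenerate_form (K : comPzRingType) (M : lmodType K) (b : M -> M -> K) :=
  forall x, (forall y, b x y = 0) -> x = 0.

Definition nonsingular_form (K : comPzRingType) (M : lmodType K) (b : M -> M -> K) :=
  nondegenerate_form b /\
  forall l : M -> K, lin_functional l -> exists x, forall y, b x y = l y.

Definition fin_presented (K : comPzRingType) (M : lmodType K) :=
  exists (n m : nat) (f : 'rV[K]_n -> M) (rel : 'I_m -> 'rV[K]_n),
    lin f /\ (forall x, exists v, f v = x) /\
    forall v, f v = 0 <-> exists c : 'I_m -> K, v = \sum_(i < m) c i *: rel i.

(* Main.v *)
(* The form on [B] is obtained by faithfully flat descent.  Over [S], pull
   [kappa_S] back along the given trivialization [theta : B_S -> a_S].  For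
   [x, y] in [B] the value [z = kappa_S (theta x) (theta y)] satisfies
   [z (x) 1 = 1 (x) z] in [S (x)_R S], because the two pullbacks of [theta]
   differ by an automorphism of [a (x) (S (x)_R S)], which preserves [kappa];
   hence [z] lies in [R].  The same comparison over [S (x)_R S'] handles an
   arbitrary trivialization, and [R -> S] being injective on every module
   transfers identities from [a_S] back to [B].  For (c), evaluation on
   generators turns nondegeneracy into injectivity of [a -> k^n], and
   surjectivity of [kappa] into solving a linear system over [k] inside [S],
   both of which only need [S] flat over [k]; then [B] is finitely generated by
   descent, and membership in the image of [B -> R^n] descends. *)
Require Import Defs.
From HB Require Import structures.
From mathcomp Require Import all_boot all_order all_algebra.
From mathcomp Require Import generic_quotient boolp.
Set Implicit Arguments. Unset Strict Implicit. Unset Printing Implicit Defensive.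
Import GRing.Theory.
Local Open Scope ring_scope.
Local Open Scope quotient_scope.

(** * Semilinear maps, kernels and cokernels *)

Section Semilinear.
Variables (K T : pzRingType) (phi : {rmorphism K -> T}).
Variables (M : lmodType K) (P : lmodType T) (f : M -> P).
Hypothesis lf : slin phi f.

Lemma slinD x y : f (x + y) = f x + f y.
Proof. by rewrite -[x]scale1r lf rmorph1 !scale1r. Qed.

Lemma slin0 : f 0 = 0.
Proof. by apply: (addrI (f 0)); rewrite -slinD !addr0. Qed.

Lemma slinZ c x : f (c *: x) = phi c *: f x.
Proof. by rewrite -[c *: x]addr0 lf slin0 addr0. Qed.

Lemma slinN x : f (- x) = - f x.
Proof. by rewrite -scaleN1r slinZ rmorphN1 scaleN1r. Qed.

Lemma slinB x y : f (x - y) = f x - f y.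
Proof. by rewrite slinD slinN. Qed.

Lemma slin_sum (I : Type) (r : seq I) (p : pred I) (F : I -> M) :
  f (\sum_(i <- r | p i) F i) = \sum_(i <- r | p i) f (F i).
Proof. by apply: (big_morph f slinD slin0). Qed.

Lemma slin_inj : (forall x, f x = 0 -> x = 0) -> injective f.
Proof. by move=> H x y e; apply/subr0_eq/H; rewrite slinB e subrr. Qed.

End Semilinear.

Section Linear.
Variables (K : pzRingType) (M P : lmodType K) (f : M -> P).
Hypothesis lf : lin f.
Let sf : slin (idfun : {rmorphism K -> K}) f := lf.

Lemma linD x y : f (x + y) = f x + f y. Proof. exact: (slinD sf). Qed.
Lemma lin0 : f 0 = 0. Proof. exact: (slin0 sf). Qed.
Lemma linZ c x : f (c *: x) = c *: f x. Proof. exact: (slinZ sf). Qed.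
Lemma linB x y : f (x - y) = f x - f y. Proof. exact: (slinB sf). Qed.
Lemma lin_sum (I : Type) (r : seq I) (p : pred I) (F : I -> M) :
  f (\sum_(i <- r | p i) F i) = \sum_(i <- r | p i) f (F i).
Proof. exact: (slin_sum sf). Qed.
Lemma lin_inj : (forall x, f x = 0 -> x = 0) -> injective f.
Proof. exact: (slin_inj sf). Qed.

End Linear.

(* The phantom [phi] selects the [K]-module structure [c x = phi c *: x]; the same
   device makes [alg_of] below a [K]-algebra. *)
Definition restr (K T : pzRingType) (phi : K -> T) (M : Type) := M.

Section Restriction.
Variables (K T : pzRingType) (phi : {rmorphism K -> T}) (M : lmodType T).
HB.instance Definition _ := GRing.Zmodule.on (restr phi M).
Let scale (c : K) (x : restr phi M) : restr phi M := phi c *: (x : M).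
Let scaleA a b v : scale a (scale b v) = scale (a * b) v.
Proof. by rewrite /scale scalerA rmorphM. Qed.
Let scale1 : left_id 1 scale.
Proof. by move=> v; rewrite /scale rmorph1 scale1r. Qed.
Let scaleDr : right_distributive scale +%R.
Proof. by move=> c u v; rewrite /scale scalerDr. Qed.
Let scaleDl v : {morph scale^~ v : a b / a + b}.
Proof. by move=> a b; rewrite /scale rmorphD scalerDl. Qed.
HB.instance Definition _ := GRing.Zmodule_isLmodule.Build K (restr phi M)
  scaleA scale1 scaleDr scaleDl.
End Restriction.

Section Kernel.
Variables (K : pzRingType) (M P : lmodType K) (f : M -> P).
Hypothesis lf : lin f.
(** The linearity proof is a phantom argument, so that closure under the module operations can be
    declared as an instance on the predicate. *)
Definition kerpred of lin f : {pred M} := fun x => f x == 0.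
Let ker_closed : submod_closed (kerpred lf).
Proof.
split; first exact/eqP/(lin0 lf).
move=> c x y /eqP ex /eqP ey; apply/eqP.
by rewrite lf ex ey scaler0 addr0.
Qed.
HB.instance Definition _ := GRing.isSubmodClosed.Build K M (kerpred lf) ker_closed.
Record kernel := Ker { kerval : M; kervalP : kerval \in kerpred lf }.
HB.instance Definition _ := [isSub for kerval].
HB.instance Definition _ := [Choice of kernel by <:].
HB.instance Definition _ := [SubChoice_isSubLmodule of kernel by <:].
End Kernel.
Lemma kernel_exists (K : pzRingType) (M P : lmodType K) (f : M -> P) : lin f ->
  exists (N : lmodType K) (i : N -> M),
    [/\ lin i, injective i, forall n, f (i n) = 0 &
        forall m, f m = 0 -> exists n, i n = m].
Proof.
move=> lf; exists (kernel lf : lmodType K), (fun x => kerval x); split.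
- by move=> c x y.
- exact: val_inj.
- by case=> x /= /eqP.
- by move=> m /eqP h; exists (Ker (h : m \in kerpred lf)).
Qed.

Section Cokernel.
Variables (K : pzRingType) (M P : lmodType K) (f : M -> P).
Hypothesis lf : lin f.
Definition cokrel (x y : P) : bool := `[< exists m, x - y = f m >].
Lemma cokrelP x y : reflect (exists m, x - y = f m) (cokrel x y).
Proof. exact: asboolP. Qed.
Lemma cokrel_refl : reflexive cokrel.
Proof. by move=> x; apply/cokrelP; exists 0; rewrite subrr (lin0 lf). Qed.
Lemma cokrel_sym : symmetric cokrel.
Proof.
suff H x y : cokrel x y -> cokrel y x by move=> x y; apply/idP/idP; apply: H.
move=> /cokrelP [m e]; apply/cokrelP; exists (- m).
by rewrite -[- m]sub0r (linB lf) (lin0 lf) sub0r -e opprB.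
Qed.
Lemma cokrel_trans : transitive cokrel.
Proof.
move=> y x z /cokrelP [m e] /cokrelP [m' e']; apply/cokrelP; exists (m + m').
by rewrite (linD lf) -e -e' addrA subrK.
Qed.
Definition cok_equiv := EquivRel cokrel cokrel_refl cokrel_sym cokrel_trans.
Definition coker := {eq_quot cok_equiv}.
HB.instance Definition _ := Choice.on coker.
Definition cokpi (x : P) : coker := \pi x.
Lemma cokpiP x y : cokpi x = cokpi y <-> exists m, x - y = f m.
Proof.
by split=> [/eqmodP /cokrelP|H] //; apply/eqmodP/cokrelP.
Qed.
Lemma cokrepr x : cokpi (repr x) = x. Proof. exact: reprK. Qed.
Let add (x y : coker) := cokpi (repr x + repr y).
Let opp (x : coker) := cokpi (- repr x).
Let scl c (x : coker) := cokpi (c *: repr x).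
(** Operations on the cokernel are computed on chosen representatives. This controls the choice up
    to the image of [f], which makes [cokpi] additive and homogeneous. *)
Lemma repr_cokpi x : exists m, repr (cokpi x) = x + f m.
Proof.
have /cokpiP [m e] : cokpi (repr (cokpi x)) = cokpi x by rewrite cokrepr.
by exists m; rewrite -e addrC subrK.
Qed.
Let piD x y : cokpi (x + y) = add (cokpi x) (cokpi y).
Proof.
have [[m em] [m' em']] := (repr_cokpi x, repr_cokpi y); rewrite /add em em'.
apply/esym/cokpiP; exists (m + m'); rewrite (linD lf).
by rewrite addrACA [LHS]addrC addKr.
Qed.
Let piN x : cokpi (- x) = opp (cokpi x).
Proof.
have [m em] := repr_cokpi x; rewrite /opp em.
by apply/cokpiP; exists m; rewrite opprK addrA addNr add0r.
Qed.
Let piZ c x : cokpi (c *: x) = scl c (cokpi x).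
Proof.
have [m em] := repr_cokpi x; rewrite /scl em.
apply/esym/cokpiP; exists (c *: m).
by rewrite scalerDr [LHS]addrC addKr (linZ lf).
Qed.
Let E x : exists y, x = cokpi y. Proof. by exists (repr x); rewrite cokrepr. Qed.
Let addA : associative add.
Proof.
by move=> x y z; have [[x' ->] [y' ->] [z' ->]] := And3 (E x) (E y) (E z);
  rewrite -!piD addrA.
Qed.
Let addC : commutative add.
Proof. by move=> x y; rewrite /add addrC. Qed.
Let add0 : left_id (cokpi 0) add.
Proof. by move=> x; have [x' ->] := E x; rewrite -piD add0r. Qed.
Let addN : left_inverse (cokpi 0) opp add.
Proof. by move=> x; have [x' ->] := E x; rewrite -piN -piD addNr. Qed.
HB.instance Definition _ := GRing.isZmodule.Build coker addA addC add0 addN.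
Let sclA a b v : scl a (scl b v) = scl (a * b) v.
Proof. by have [v' ->] := E v; rewrite -!piZ scalerA. Qed.
Let scl1 : left_id 1 scl.
Proof. by move=> v; have [v' ->] := E v; rewrite -!piZ scale1r. Qed.
Let sclDr : right_distributive scl +%R.
Proof.
move=> c u v; have [[u' ->] [v' ->]] := (E u, E v).
by rewrite -[cokpi u' + _]piD -!piZ scalerDr; apply: piD.
Qed.
Let sclDl v : {morph scl^~ v : a b / a + b}.
Proof.
move=> c d; have [v' ->] := E v.
by rewrite -!piZ scalerDl; apply: piD.
Qed.
HB.instance Definition _ := GRing.Zmodule_isLmodule.Build K coker
  sclA scl1 sclDr sclDl.
Lemma cokpi_lin : lin cokpi.
Proof. by move=> c x y; rewrite [LHS]piD piZ. Qed.
End Cokernel.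

Lemma cokernel_exists (K : pzRingType) (M P : lmodType K) (f : M -> P) :
  lin f -> exists (Q : lmodType K) (p : P -> Q),
    [/\ lin p, forall q, exists x, p x = q, forall m, p (f m) = 0 &
        forall x, p x = 0 -> exists m, x = f m].
Proof.
move=> lf; exists (coker lf : lmodType K), (cokpi lf).
have pl := cokpi_lin lf; split=> //.
- by move=> q; exists (repr q); apply: cokrepr.
- move=> m; rewrite -[RHS](lin0 pl); apply/cokpiP; exists m.
  by rewrite subr0.
- by move=> x; rewrite -{1}(lin0 pl) => /cokpiP [m]; rewrite subr0; exists m.
Qed.

(** * Base change of modules *)

Section BaseChange.
Variables (K T : comPzRingType) (phi : {rmorphism K -> T}) (M : lmodType K).
Implicit Type Q : zmodType.

(** Values lie in a bare abelian group, so that one quotient can serve [T]-linear and [K]-linear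
    targets alike. *)
Definition balanced (Q : zmodType) (b : T -> M -> Q) :=
  [/\ forall m s t, b (s + t) m = b s m + b t m,
      forall t m n, b t (m + n) = b t m + b t n &
      forall t c m, b (t * phi c) m = b t (c *: m)].

Definition tsum (Q : zmodType) (b : T -> M -> Q) (s : seq (T * M)) : Q :=
  \sum_(p <- s) b p.1 p.2.

Lemma tsum_cat Q (b : T -> M -> Q) s1 s2 :
  tsum b (s1 ++ s2) = tsum b s1 + tsum b s2.
Proof. by rewrite /tsum big_cat. Qed.

Lemma tsum_mul Q (b : T -> M -> Q) c s :
  tsum b [seq (c * p.1, p.2) | p <- s] = tsum (fun t => b (c * t)) s.
Proof. by rewrite /tsum big_map. Qed.

(* Identifying the formal sums on which all balanced maps agree makes the module
   axioms immediate and yields both the universal property of base change and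
   that of the tensor product over [K]. *)
Definition tens_rel s1 s2 :=
  `[< forall (Q : zmodType) (b : T -> M -> Q),
        balanced b -> tsum b s1 = tsum b s2 >].
Lemma tens_relP s1 s2 : reflect (forall (Q : zmodType) (b : T -> M -> Q),
  balanced b -> tsum b s1 = tsum b s2) (tens_rel s1 s2).
Proof. exact: asboolP. Qed.
Lemma tens_refl : reflexive tens_rel.
Proof. by move=> s; apply/tens_relP. Qed.
Lemma tens_sym : symmetric tens_rel.
Proof.
by move=> s1 s2; apply/tens_relP/tens_relP => H Q b hb; rewrite H.
Qed.
Lemma tens_trans : transitive tens_rel.
Proof.
move=> s1 s2 s3 /tens_relP H1 /tens_relP H2; apply/tens_relP => Q b hb.
by rewrite H1 ?H2.
Qed.
Definition tens_equiv := EquivRel tens_rel tens_refl tens_sym tens_trans.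
Definition tens := {eq_quot tens_equiv}.
HB.instance Definition _ := Choice.on tens.

Definition tlift (Q : zmodType) (b : T -> M -> Q) (x : tens) := tsum b (repr x).
Definition tpi s : tens := \pi s.

Lemma tlift_pi Q (b : T -> M -> Q) s : balanced b -> tlift b (tpi s) = tsum b s.
Proof.
move=> hb; have /eqmodP/tens_relP : tpi (repr (tpi s)) = tpi s by apply: reprK.
exact.
Qed.

Lemma tens_ext (x y : tens) :
  (forall (Q : zmodType) (b : T -> M -> Q), balanced b -> tlift b x = tlift b y) ->
  x = y.
Proof.
move=> H; rewrite -[x]reprK -[y]reprK; apply/eqmodP/tens_relP => Q b hb.
exact: H.
Qed.

Lemma balanced_mul Q (b : T -> M -> Q) c :
  balanced b -> balanced (fun t => b (c * t)).
Proof.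
by move=> [h1 h2 h3]; split=> *; rewrite ?mulrDr ?mulrA ?h1 ?h2 ?h3.
Qed.

Let add (x y : tens) := tpi (repr x ++ repr y).
Let opp (x : tens) := tpi [seq ((-1) * p.1, p.2) | p <- repr x].
Let scl c (x : tens) := tpi [seq (c * p.1, p.2) | p <- repr x].
Let liftD Q (b : T -> M -> Q) x y : balanced b ->
  tlift b (add x y) = tlift b x + tlift b y.
Proof. by move=> hb; rewrite tlift_pi // tsum_cat. Qed.
Let liftZ Q (b : T -> M -> Q) c x : balanced b ->
  tlift b (scl c x) = tlift (fun t => b (c * t)) x.
Proof. by move=> hb; rewrite tlift_pi // tsum_mul. Qed.
Let lift0 Q (b : T -> M -> Q) : balanced b -> tlift b (tpi [::]) = 0.
Proof. by move=> hb; rewrite tlift_pi // /tsum big_nil. Qed.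
Let liftN Q (b : T -> M -> Q) x : balanced b -> tlift b (opp x) = - tlift b x.
Proof.
move=> hb; rewrite tlift_pi // tsum_mul /tlift /tsum -sumrN.
apply: eq_bigr => p _; apply/eqP; rewrite -subr_eq0 opprK mulN1r.
have [h1 _ _] := hb; rewrite -h1 addNr.
by apply/eqP/(addrI (b 0 p.2)); rewrite -h1 !addr0.
Qed.
Let addA : associative add.
Proof. by move=> x y z; apply: tens_ext => Q b hb; rewrite !liftD // addrA. Qed.
Let addC : commutative add.
Proof. by move=> x y; apply: tens_ext => Q b hb; rewrite !liftD // addrC. Qed.
Let add0 : left_id (tpi [::]) add.
Proof. by move=> x; apply: tens_ext => Q b hb; rewrite liftD // lift0 // add0r. Qed.
Let addN : left_inverse (tpi [::]) opp add.
Proof.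
by move=> x; apply: tens_ext => Q b hb; rewrite liftD // liftN // lift0 // addNr.
Qed.
HB.instance Definition _ := GRing.isZmodule.Build tens addA addC add0 addN.
Let sclA c d v : scl c (scl d v) = scl (c * d) v.
Proof.
apply: tens_ext => Q b hb; rewrite !liftZ //; last exact: balanced_mul.
by apply: eq_bigr => p _; rewrite mulrA.
Qed.
Let scl1 : left_id 1 scl.
Proof.
by move=> v; apply: tens_ext => Q b hb; rewrite liftZ //;
  apply: eq_bigr => p _; rewrite mul1r.
Qed.
Let sclDr : right_distributive scl +%R.
Proof.
move=> c u v; apply: tens_ext => Q b hb; have hb' := balanced_mul c hb.
by rewrite liftZ // [LHS]liftD // [RHS]liftD // !liftZ.
Qed.
Let sclDl v : {morph scl^~ v : c d / c + d}.
Proof.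
move=> c d; apply: tens_ext => Q b hb; rewrite [RHS]liftD // !liftZ //.
rewrite /tlift /tsum -big_split /=; apply: eq_bigr => p _.
by rewrite mulrDl; case: hb => ->.
Qed.
HB.instance Definition _ := GRing.Zmodule_isLmodule.Build T tens
  sclA scl1 sclDr sclDl.

Definition tin (m : M) : tens := tpi [:: (1, m)].

Lemma tliftD Q (b : T -> M -> Q) x y : balanced b ->
  tlift b (x + y) = tlift b x + tlift b y.
Proof. exact: liftD. Qed.

Lemma tliftZ Q (b : T -> M -> Q) c x : balanced b ->
  tlift b (c *: x) = tlift (fun t => b (c * t)) x.
Proof. exact: liftZ. Qed.

Lemma tlift_tin Q (b : T -> M -> Q) m : balanced b -> tlift b (tin m) = b 1 m.
Proof. by move=> hb; rewrite tlift_pi // /tsum big_seq1. Qed.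

Lemma tin_slin : slin phi tin.
Proof.
move=> c x y; apply: tens_ext => Q b hb; have hb' := balanced_mul (phi c) hb.
rewrite tliftD // tliftZ // !tlift_tin //.
by case: hb => h1 h2 h3; rewrite h2 -h3 mulrC.
Qed.

Lemma tens_gen (x : tens) :
  exists s : seq (T * M), x = \sum_(p <- s) p.1 *: tin p.2.
Proof.
exists (repr x); apply: tens_ext => Q b hb; rewrite {1}/tlift.
elim: (repr x) => [|p s IH]; first by rewrite /tsum !big_nil; rewrite [RHS]lift0.
rewrite /tsum !big_cons tliftD // tliftZ // tlift_tin; last exact: balanced_mul.
by rewrite mulr1 -IH.
Qed.

Lemma balanced_slin (P : lmodType T) (f : M -> P) : slin phi f ->
  balanced (fun t m => t *: f m).
Proof.
move=> lf; split=> *; rewrite ?scalerDl //.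
  by rewrite (slinD lf) scalerDr.
by rewrite (slinZ lf) scalerA.
Qed.

Lemma tens_base_change : is_base_change phi tin.
Proof.
split; first exact: tin_slin.
move=> P f lf; split.
  have hb := balanced_slin lf; exists (tlift (fun t m => t *: f m)); split.
    move=> c x y; rewrite tliftD // tliftZ //; congr (_ + _).
    by rewrite /tlift /tsum scaler_sumr; apply: eq_bigr => p _; rewrite scalerA.
  by move=> m; rewrite tlift_tin // scale1r.
move=> g1 g2 l1 l2 E x; have [s ->] := tens_gen x.
rewrite (lin_sum l1) (lin_sum l2); apply: eq_bigr => p _.
by rewrite (linZ l1) (linZ l2) E.
Qed.

Section UniversalProperty.
Variables (P : lmodType T) (i : M -> P).
Hypothesis hP : is_base_change phi i.

Lemma bc_slin : slin phi i. Proof. by case: hP. Qed.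

Lemma bc_uniq (Q : lmodType T) (g1 g2 : P -> Q) : lin g1 -> lin g2 ->
  (forall m, g1 (i m) = g2 (i m)) -> forall x, g1 x = g2 x.
Proof.
move=> l1 l2 E; have /hP.2 [_ U] : slin phi (g1 \o i); last exact: U.
by move=> c x y /=; rewrite bc_slin l1.
Qed.

(** Facts read off the explicit model [tens] pass through this isomorphism to every base change, in
    particular generation by the image of [i]. *)
Lemma tens_iso : exists (h : tens -> P) (h' : P -> tens),
  [/\ lin h, lin h', cancel h h', cancel h' h & forall m, h (tin m) = i m].
Proof.
have [[h [lh Eh]] _] := tens_base_change.2 P i bc_slin.
have [[h' [lh' Eh']] _] := hP.2 tens tin tin_slin.
exists h, h'; split=> //.
  apply: (tens_base_change.2 _ _ tin_slin).2 => //.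
    by move=> c x y; rewrite lh lh'.
  by move=> m /=; rewrite Eh Eh'.
by apply: bc_uniq => // [c x y|m] /=; rewrite ?lh' ?lh // Eh' Eh.
Qed.

Lemma bc_gen (x : P) : exists s : seq (T * M), x = \sum_(p <- s) p.1 *: i p.2.
Proof.
have [h [h' [lh lh' _ hK Eh]]] := tens_iso.
have [s Es] := tens_gen (h' x); exists s; rewrite -[x]hK Es (lin_sum lh).
by apply: eq_bigr => p _; rewrite (linZ lh) Eh.
Qed.

Lemma bc_ind (A : P -> Prop) : (forall t m x, A x -> A (t *: i m + x)) -> A 0 ->
  forall x, A x.
Proof.
move=> HD H0 x; have [s ->] := bc_gen x.
by elim: s => [|p s IH]; rewrite ?big_nil ?big_cons //; apply: HD.
Qed.

(** Flatness is phrased with [is_tensor], so the semilinear universal property has to imply the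
    bilinear one over [K]. A bilinear map is balanced, hence lifts to [tens] and is transported by
    [tens_iso]; uniqueness is generation. *)
Lemma bc_tensor :
  is_tensor (fun (t : restr phi T^o) m => (t *: i m : P) : restr phi P).
Proof.
split.
  split=> [t|m] c x y.
    by rewrite bc_slin scalerDr scalerA mulrC -scalerA.
  by rewrite scalerDl -scalerA.
move=> Q b [bl br].
have hb : @balanced Q b.
  split=> [m s t|t m n|t c m].
  - exact: (linD (br m)).
  - exact: (linD (bl t)).
  - by rewrite (linZ (bl t)) -(linZ (br m)) mulrC.
split; last first.
  move=> g1 g2 l1 l2 E x; have [s ->] := bc_gen x.
  rewrite (lin_sum l1) (lin_sum l2); apply: eq_bigr => p _; exact: E.
have [h [h' [lh lh' h'K _ Eh]]] := tens_iso.
exists (fun p => tlift b (h' p)); split.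
  move=> c x y; rewrite (lh' (phi c)) tliftD // tliftZ //; congr (_ + _).
  rewrite /tlift /tsum scaler_sumr; apply: eq_bigr => p _.
  by rewrite -(linZ (br _)).
move=> t m /=; rewrite -Eh (linZ lh') h'K tliftZ // tlift_tin ?mulr1 //.
exact: balanced_mul.
Qed.
End UniversalProperty.
End BaseChange.

Definition bislin (K T : pzRingType) (phi : K -> T) (M N : lmodType K)
    (P : lmodType T) (b : M -> N -> P) :=
  (forall m, slin phi (b m)) /\ (forall n, slin phi (b^~ n)).

(** * Change of rings and transitivity of base change *)

Section ChangeOfRings.
Variables (K T U : comPzRingType).
Variables (phi : {rmorphism K -> T}) (q : {rmorphism T -> U}).
Variables (psi : {rmorphism K -> U}) (psiE : psi =1 q \o phi).
Variables (M : lmodType K) (MT : lmodType T) (i : M -> MT).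
Hypothesis hM : is_base_change phi i.

Lemma bc_lift (P : lmodType U) (f : M -> P) : slin psi f ->
  exists g : MT -> P, slin q g /\ forall m, g (i m) = f m.
Proof.
move=> lf; apply: (hM.2 (restr q P) f _).1 => c x y.
by rewrite lf psiE.
Qed.

Lemma bc_suniq (P : lmodType U) (g1 g2 : MT -> P) : slin q g1 -> slin q g2 ->
  (forall m, g1 (i m) = g2 (i m)) -> forall x, g1 x = g2 x.
Proof. by move=> l1 l2; apply: (bc_uniq hM (Q := restr q P)). Qed.

Lemma bc_suniq2 (P : lmodType U) (b1 b2 : MT -> MT -> P) :
  bislin q b1 -> bislin q b2 ->
  (forall m n, b1 (i m) (i n) = b2 (i m) (i n)) -> forall x y, b1 x y = b2 x y.
Proof.
move=> [l1 r1] [l2 r2] E x y; move: x; apply: bc_suniq => // m.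
by move: y; apply: bc_suniq.
Qed.

(** A map on [MT] that is semilinear over [q] restricts to one on [M] over [psi], which extends to
    [MU]; uniqueness on [MT] identifies it with the given map. *)
Lemma bc_trans (MU : lmodType U) (j : M -> MU) (w : MT -> MU) :
  is_base_change psi j -> slin q w -> (forall m, w (i m) = j m) ->
  is_base_change q w.
Proof.
move=> hU lw Ew; split=> // P f lf.
have lfi : slin psi (f \o i) by move=> c x y /=; rewrite (bc_slin hM) lf psiE.
have [[g [lg Eg]] _] := hU.2 P _ lfi; split.
  exists g; split=> //; apply: bc_suniq => // [c x y|m]; last by rewrite Ew Eg.
  by rewrite lw lg.
by move=> g1 g2 l1 l2 E; apply: (bc_uniq hU) => // m; rewrite -Ew E.
Qed.

End ChangeOfRings.

(** One variable is extended at a time. [F] extends the first for each fixed [n], and uniqueness of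
    these extensions makes [F] semilinear in [n], so the second variable extends to give [G];
    uniqueness again keeps [G] linear in the first. *)
Lemma bislin_lift (K T : comPzRingType) (phi : {rmorphism K -> T})
    (M N : lmodType K) (MT NT P : lmodType T) (i : M -> MT) (j : N -> NT)
    (b : M -> N -> P) :
  is_base_change phi i -> is_base_change phi j -> bislin phi b ->
  exists bT : MT -> NT -> P, bilin bT /\ forall m n, bT (i m) (j n) = b m n.
Proof.
move=> hi hj [bl br].
have [F HF] := choice (fun n => (hi.2 P _ (br n)).1).
have lF x : slin phi (F^~ x).
  move=> c n n'; move: x; apply: (bc_uniq hi).
  - exact: (HF _).1.
  - move=> d x y; rewrite !(HF _).1 !scalerDr !scalerA mulrC.
    by rewrite addrACA.
  - by move=> m; rewrite !(HF _).2 bl.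
have [G HG] := choice (fun x => (hj.2 P _ (lF x)).1).
exists G; split; last by move=> m n; rewrite (HG _).2 (HF _).2.
split=> [x|y]; first exact: (HG _).1.
move=> c x x'; move: y; apply: (bc_uniq hj).
- exact: (HG _).1.
- move=> d y y'; rewrite !(HG _).1 !scalerDr !scalerA mulrC.
  by rewrite addrACA.
- by move=> n; rewrite !(HG _).2 (HF _).1.
Qed.

Section BaseChangeExistence.
Variables (K T : comPzRingType) (phi : {rmorphism K -> T}) (M : lmodType K).

Lemma form_bc_exists (MT : lmodType T) (i : M -> MT) (kappa : M -> M -> K) :
  is_base_change phi i -> bilin_form kappa ->
  exists kT, is_form_base_change phi kappa i kT.
Proof.
move=> hM [kl kr].
have hb : bislin phi (fun m n => phi (kappa m n) : T^o).
  by split=> z c x y; rewrite ?kl ?kr rmorphD rmorphM.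
have [kT [[l r] E]] := bislin_lift hM hM hb.
by exists kT.
Qed.

Lemma alg_bc_exists (mul : M -> M -> M) : bilin_op mul ->
  exists (MT : lmodType T) (i : M -> MT) mulT, is_alg_base_change phi mul i mulT.
Proof.
move=> [kl kr]; have hM := tens_base_change phi M.
have hb : bislin phi (fun m n => tin phi (mul m n)).
  by split=> z c x y; rewrite ?kl ?kr (bc_slin hM).
have [kT [lr E]] := bislin_lift hM hM hb.
by exists (tens phi M), (tin phi (M := M)), kT.
Qed.

End BaseChangeExistence.

Section Compatibility.
Variables (K T U : comPzRingType).
Variables (phi : {rmorphism K -> T}) (q : {rmorphism T -> U}).
Variables (psi : {rmorphism K -> U}) (psiE : psi =1 q \o phi).
Variables (M : lmodType K) (MT : lmodType T) (i : M -> MT).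
Variables (MU : lmodType U) (j : M -> MU) (w : MT -> MU).
Hypotheses (hM : is_base_change phi i) (lw : slin q w).
Hypothesis (Ew : forall m, w (i m) = j m).

Lemma form_bc_compat kappa mu muU : is_form_base_change phi kappa i mu ->
  is_form_base_change psi kappa j muU ->
  forall x y, muU (w x) (w y) = q (mu x y).
Proof.
move=> [[ml mr] Em] [[ul ur] Eu].
apply: (@bc_suniq2 _ _ _ phi q _ _ _ hM U^o); last first.
- by move=> m n; rewrite !Ew Eu Em psiE.
- by split=> z c x y; rewrite ?ml ?mr rmorphD rmorphM.
- by split=> z c x y; rewrite lw ?ul ?ur.
Qed.

Lemma alg_bc_compat mul mT mU : is_alg_base_change phi mul i mT ->
  is_alg_base_change psi mul j mU ->
  forall x y, mU (w x) (w y) = w (mT x y).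
Proof.
move=> [_ [[ml mr] Em]] [_ [[ul ur] Eu]].
apply: (@bc_suniq2 _ _ _ phi q _ _ _ hM MU); last first.
- by move=> m n; rewrite !Ew Eu Em Ew.
- by split=> z c x y; rewrite ?ml ?mr lw.
- by split=> z c x y; rewrite lw ?ul ?ur.
Qed.

Lemma alg_bc_trans mul mT mU : is_alg_base_change phi mul i mT ->
  is_alg_base_change psi mul j mU -> is_alg_base_change q mT w mU.
Proof.
move=> h1 h2; split; last by split; [case: h2 => _ []|apply: alg_bc_compat h1 h2].
exact: (bc_trans psiE hM h2.1).
Qed.

End Compatibility.

Lemma alg_iso_inv (T : comPzRingType) (M N : lmodType T) mulM mulN (f : M -> N) :
  alg_iso mulM mulN f ->
  exists g, [/\ alg_iso mulN mulM g, cancel f g & cancel g f].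
Proof.
move=> [lf [[g fK gK] mf]]; exists g; split=> //; split; last split.
- by move=> c x y; apply: (can_inj fK); rewrite lf !gK.
- by exists f.
- by move=> x y; apply: (can_inj fK); rewrite mf !gK.
Qed.

Lemma alg_iso_comp (T : comPzRingType) (M N P : lmodType T) mulM mulN mulP
    (f : M -> N) (g : N -> P) :
  alg_iso mulM mulN f -> alg_iso mulN mulP g -> alg_iso mulM mulP (g \o f).
Proof.
move=> [lf [bf mf]] [lg [bg mg]]; split; last split.
- by move=> c x y /=; rewrite lf lg.
- exact: bij_comp.
- by move=> x y /=; rewrite mf mg.
Qed.

(** [theta] and its inverse both extend. Uniqueness makes the extensions mutually inverse, and
    bilinearity reduces multiplicativity to the image of [w]. *)
Lemma alg_iso_bc (T U : comPzRingType) (q : {rmorphism T -> U})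
    (MT NT : lmodType T) (MU NU : lmodType U) (w : MT -> MU) (v : NT -> NU)
    mMT mNT mMU mNU (theta : MT -> NT) :
  is_alg_base_change q mMT w mMU -> is_alg_base_change q mNT v mNU ->
  alg_iso mMT mNT theta ->
  exists thetaU, alg_iso mMU mNU thetaU /\ forall x, thetaU (w x) = v (theta x).
Proof.
move=> [hw [[bMl bMr] Ew]] [hv [[bNl bNr] Ev]] ht.
have [theta' [[lt' [_ mt']] tK t'K]] := alg_iso_inv ht.
case: ht => lt [_ mt].
have l1 : slin q (v \o theta) by move=> c x y /=; rewrite lt (bc_slin hv).
have l2 : slin q (w \o theta') by move=> c x y /=; rewrite lt' (bc_slin hw).
have [[g [lg Eg]] _] := hw.2 _ _ l1.
have [[h [lh Eh]] _] := hv.2 _ _ l2.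
exists g; split; last exact: Eg.
split=> //; split.
  exists h.
    apply: (bc_uniq hw) => //; first by move=> c x y; rewrite lg lh.
    by move=> m; rewrite Eg Eh /= tK.
  apply: (bc_uniq hv) => //; first by move=> c x y; rewrite lh lg.
  by move=> m; rewrite Eh Eg /= t'K.
apply: (bc_suniq2 (q := idfun) hw).
- by split=> z c x y; rewrite ?bMl ?bMr lg.
- by split=> z c x y; rewrite lg ?bNl ?bNr.
- by move=> m n; rewrite Ew !Eg /= Ev mt.
Qed.

(** * Flatness and faithfully flat descent *)

(** Flatness of [T] over [K] with the base changes kept as [T]-modules; in this form it applies to
    any ring morphism and composes along towers. *)
Definition bc_flat (K T : comPzRingType) (phi : {rmorphism K -> T}) :=
  forall (N1 N2 : lmodType K) (f : N1 -> N2), lin f -> injective f ->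
  forall (P1 P2 : lmodType T) (i1 : N1 -> P1) (i2 : N2 -> P2),
    is_base_change phi i1 -> is_base_change phi i2 ->
    forall g : P1 -> P2, lin g -> (forall n, g (i1 n) = i2 (f n)) ->
    injective g.

Definition bc_faithful (K T : comPzRingType) (phi : {rmorphism K -> T}) :=
  bc_flat phi /\
  forall (N : lmodType K) (P : lmodType T) (i : N -> P), is_base_change phi i ->
    (forall p : P, p = 0) -> forall n : N, n = 0.

(** The given [K]-module structure on [T] and the one restricted along [in_alg] agree only
    propositionally, by [mulr_algl]; the difference is absorbed here. *)
Lemma bc_tensor_alg (K : comNzRingType) (T : comAlgType K) (N : lmodType K)
    (P : lmodType T) (i : N -> P) : is_base_change (GRing.in_alg T) i ->
  is_tensor (fun (t : T : lmodType K) n => (t *: i n : restr (GRing.in_alg T) P)).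
Proof.
move=> hP; have [[tl tr] tU] := bc_tensor hP.
split; first by split=> // n c x y; rewrite -mulr_algl; apply: (tr n).
move=> Q b [bl br]; apply: tU; split=> // n c x y.
by rewrite -br -mulr_algl.
Qed.

Lemma flat_bc (K : comNzRingType) (T : comAlgType K) :
  flat (T : lmodType K) -> bc_flat (GRing.in_alg T).
Proof.
move=> fl N1 N2 f lf fI P1 P2 i1 i2 h1 h2 g lg Eg.
apply: (fl _ _ f lf fI _ _ _ _ (bc_tensor_alg h1) (bc_tensor_alg h2)).
  by move=> c x y; apply: lg.
by move=> t n; rewrite (linZ lg) Eg.
Qed.

Lemma faithfully_flat_bc (K : comNzRingType) (T : comAlgType K) :
  faithfully_flat (T : lmodType K) -> bc_faithful (GRing.in_alg T).
Proof.
move=> [fl ff]; split; first exact: flat_bc.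
by move=> N P i hP; apply: (ff _ _ _ (bc_tensor_alg hP)).
Qed.

(** The intermediate base change [fT] over [T] is injective by flatness of [phi], and [g] is the
    base change of [fT] along [q]. *)
Lemma bc_flat_comp (K T U : comPzRingType) (phi : {rmorphism K -> T})
    (q : {rmorphism T -> U}) (psi : {rmorphism K -> U}) :
  psi =1 q \o phi -> bc_flat phi -> bc_flat q -> bc_flat psi.
Proof.
move=> E fphi fq N1 N2 f lf fI P1 P2 i1 i2 h1 h2 g lg Eg.
have b1 := tens_base_change phi N1; have b2 := tens_base_change phi N2.
have [w1 [lw1 Ew1]] := bc_lift E b1 (bc_slin h1).
have [w2 [lw2 Ew2]] := bc_lift E b2 (bc_slin h2).
have sf : slin phi (tin phi (M := N2) \o f).
  by move=> c x y /=; rewrite lf (bc_slin b2).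
have [[fT [lfT EfT]] _] := b1.2 _ _ sf.
apply: (fq _ _ fT lfT _ _ _ w1 w2) => //.
- exact: fphi lf fI _ _ _ _ b1 b2 fT lfT EfT.
- exact: (bc_trans E b1 h1 lw1 Ew1).
- exact: (bc_trans E b2 h2 lw2 Ew2).
apply: (bc_suniq (q := q) b1).
- by move=> c x y; rewrite lw1 lg.
- by move=> c x y; rewrite lfT lw2.
- by move=> m; rewrite Ew1 Eg EfT Ew2.
Qed.

Section Faithful.
Variables (K T : comPzRingType) (phi : {rmorphism K -> T}).
Hypothesis ff : bc_faithful phi.

(** Let [I] be the kernel of [i]. By flatness its base change embeds in [P], but the embedding sends
    the generators to [i (j m) = 0]. So the base change vanishes, and faithfulness gives [I = 0]. *)
Lemma faithful_inj (N : lmodType K) (P : lmodType T) (i : N -> P) :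
  is_base_change phi i -> forall n, i n = 0 -> n = 0.
Proof.
move=> hP n en.
have li : lin (i : N -> restr phi P) by exact: (bc_slin hP).
have [I [j [lj jI ij ji]]] := kernel_exists li.
have b := tens_base_change phi I.
have lij : slin phi (i \o j) by move=> c x y /=; rewrite lj (bc_slin hP).
have [[g [lg Eg]] _] := b.2 _ _ lij.
have gI : injective g by apply: (ff.1 _ _ j lj jI _ _ _ _ b hP).
have I0 : forall x : I, x = 0.
  apply: (ff.2 _ _ _ b) => p; apply: gI; rewrite (lin0 lg).
  have l0 : lin (fun _ : tens phi I => 0 : P).
    by move=> c x y; rewrite scaler0 addr0.
  by apply: (bc_uniq b lg l0) => m; rewrite Eg [LHS]ij.
by have [x <-] := ji n en; rewrite (I0 x) (lin0 lj).
Qed.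

(** The class of [n] in the cokernel [Q] of [f] becomes zero after base change, because [g \o fT]
    kills the generators of [MT]; by [faithful_inj] it was zero already. *)
Lemma faithful_descent_mem (M N : lmodType K) (f : M -> N) (MT NT : lmodType T)
    (i : M -> MT) (j : N -> NT) (fT : MT -> NT) :
  lin f -> is_base_change phi i -> is_base_change phi j ->
  lin fT -> (forall m, fT (i m) = j (f m)) ->
  forall n, (exists x, fT x = j n) -> exists m, f m = n.
Proof.
move=> lf hi hj lfT EfT n [x ex].
have [Q [p [lp _ pf fp]]] := cokernel_exists lf.
have b := tens_base_change phi Q.
have lpi : slin phi (tin phi (M := Q) \o p).
  by move=> c u v /=; rewrite lp (bc_slin b).
have [[g [lg Eg]] _] := hj.2 _ _ lpi.
suff : p n = 0 by move=> /fp [m ->]; exists m.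
apply: (faithful_inj b); rewrite -[LHS]Eg -ex.
have l0 : lin (fun _ : MT => 0 : tens phi Q).
  by move=> c u v; rewrite scaler0 addr0.
have lc : lin (g \o fT) by move=> c u v /=; rewrite lfT lg.
apply: (bc_uniq hi lc l0) => m.
by rewrite /= EfT Eg /= pf (slin0 (bc_slin b)).
Qed.

End Faithful.

(** The ring is the base change to [S] of [S'] viewed as a [K]-module, with the product lifted from
    [S']; its axioms are multilinear, so they are checked on the image of [S']. That [q'] is itself
    a base change along [phi] makes [faithful_inj] and [faithful_descent_mem] applicable to it. *)
Lemma tensor_ring (K S : comPzRingType) (S' : comNzRingType)
    (phi : {rmorphism K -> S}) (psi : {rmorphism K -> S'}) :
  bc_faithful phi ->
  exists (T : comNzRingType) (q : {rmorphism S -> T}) (q' : {rmorphism S' -> T}),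
    q \o phi =1 q' \o psi /\
    @is_base_change _ _ phi (restr psi S'^o) (restr q T^o) q'.
Proof.
move=> ff; pose N : lmodType K := restr psi S'^o.
have b := tens_base_change phi N; have lt := bc_slin b.
have hb : bislin phi (fun x y : N => tin phi (x * y : N)).
  split=> z c x y; rewrite -lt; congr (tin phi _).
    by rewrite [LHS]mulrDr; congr (_ + _); exact: mulrCA.
  by rewrite [LHS]mulrDl; congr (_ + _); rewrite -[LHS]mulrA.
have [mul [[ml mr] Em]] := bislin_lift b b hb.
pose one : tens phi N := tin phi (1 : N).
have mulC : commutative mul.
  apply: (bc_suniq2 (q := idfun) b) => // x y.
  by rewrite !Em; congr (tin phi _); exact: mulrC.
have mul1 : left_id one mul.
  apply: (bc_uniq b) => // m; rewrite Em; congr (tin phi _); exact: mul1r.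
have mulA : associative mul.
  move=> x y z; move: x y; apply: (bc_suniq2 (q := idfun) b).
  - split=> u c x y; first by rewrite mr ml.
    by rewrite mr.
  - split=> u c x y; first by rewrite ml mr.
    by rewrite mr mr.
  - move=> x y; move: z; apply: (bc_uniq b) => // [c u v|m].
      by rewrite ml ml.
    by rewrite !Em; congr (tin phi _); exact: mulrA.
have mulD : left_distributive mul +%R by move=> x y z; rewrite (linD (mr z)).
(* The unit is the image of [1] under [tin], which is injective by faithful flatness, and [1] is
   nonzero in [S']. *)
have nz : one != 0.
  apply/eqP => /(faithful_inj ff b) e; have /eqP := oner_neq0 S'; exact.
pose T : comNzRingType := HB.pack (tens phi N)
  (GRing.Zmodule_isComNzRing.Build (tens phi N) mulA mulC mul1 mulD nz).
pose q0 (s : S) : T := s *: one.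
pose q0' (s : S') : T := tin phi (s : N).
have q0D : {morph q0 : x y / x - y} by move=> x y; exact: scalerBl.
have q0M : {morph q0 : x y / x * y}.
  move=> x y; rewrite /q0 /GRing.mul /= (linZ (mr _)) (linZ (ml _)).
  by rewrite mul1 scalerA.
have q01 : q0 1 = 1 by exact: scale1r.
have q0D' : {morph q0' : x y / x - y} by move=> x y; exact: (slinB lt).
have q0M' : {morph q0' : x y / x * y} by move=> x y; exact/esym/Em.
have q01' : q0' 1 = 1 by [].
pose q : {rmorphism S -> T} := HB.pack q0 (GRing.isZmodMorphism.Build _ _ q0 q0D)
  (GRing.isMonoidMorphism.Build _ _ q0 (q01, q0M)).
pose q' : {rmorphism S' -> T} := HB.pack q0' (GRing.isZmodMorphism.Build _ _ q0' q0D')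
  (GRing.isMonoidMorphism.Build _ _ q0' (q01', q0M')).
exists T, q, q'; split.
  move=> c /=; rewrite /q0 /q0' -(slinZ lt); congr (tin phi _); exact: mulr1.
split.
  move=> c x y; rewrite [LHS]lt; congr (_ + _).
  by rewrite -[tin phi x](mul1) -(linZ (mr _)).
move=> P f lf; have [[g [lg Eg]] u] := b.2 P f lf.
(* The [S]-structure of [tens] and the one restricted along [q] agree through the unit law of [mul],
   not by computation. *)
have sc c (x : tens phi N) : c *: (x : restr q T^o) = c *: x.
  by rewrite -[in RHS](mul1 x) -(linZ (mr _)).
split.
  exists g; split=> // c x y; rewrite -lg; congr (g (_ + _)); exact: sc.
move=> g1 g2 l1 l2 E x; apply: u => //.
- by move=> c y z; rewrite -l1; congr (g1 (_ + _)); exact/esym/sc.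
- by move=> c y z; rewrite -l2; congr (g2 (_ + _)); exact/esym/sc.
Qed.

(** * Finiteness and base change of forms *)

Lemma slin_factor (K T : pzRingType) (phi : {rmorphism K -> T})
    (M N : lmodType K) (P : lmodType T) (p : M -> N) (f : M -> P) :
  lin p -> (forall y, exists x, p x = y) -> slin phi f ->
  (forall x, p x = 0 -> f x = 0) ->
  exists h : N -> P, slin phi h /\ forall x, h (p x) = f x.
Proof.
move=> lp sp lf pf; have [r rK] := choice sp.
have fE x y : p x = p y -> f x = f y.
  move=> e; apply/subr0_eq; rewrite -(slinB lf); apply: pf.
  by rewrite (linB lp) e subrr.
exists (f \o r); split=> [c x y|x] /=; last exact: fE.
by rewrite -lf; apply: fE; rewrite lp !rK.
Qed.

(* [M / ker g] embeds in [N], so it still embeds after base change; right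
   exactness identifies its base change with [MT / T (ker g)]. *)
Lemma flat_kernel (K T : comPzRingType) (phi : {rmorphism K -> T})
    (M N : lmodType K) (MT NT : lmodType T) (i : M -> MT) (j : N -> NT)
    (g : M -> N) (gT : MT -> NT) :
  bc_flat phi -> is_base_change phi i -> is_base_change phi j ->
  lin g -> lin gT -> (forall m, gT (i m) = j (g m)) ->
  forall p, gT p = 0 -> exists s : seq (T * M),
    (forall x, x \in s -> g x.2 = 0) /\ p = \sum_(x <- s) x.1 *: i x.2.
Proof.
move=> fl hi hj lg lgT EgT p gp.
have li := bc_slin hi.
have [N0 [v [lv vI gv vg]]] := kernel_exists lg.
have [I [c [lc cS cv vc]]] := cokernel_exists lv.
have [h [lh Eh]] : exists h : I -> N, lin h /\ forall x, h (c x) = g x.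
  apply: (slin_factor (phi := idfun)) => // x /vc [m ->]; exact: gv.
have hI : injective h.
  apply: (lin_inj lh) => x; have [y <-] := cS x.
  by rewrite Eh => /vg [n <-]; apply: cv.
have b0 := tens_base_change phi N0; have bI := tens_base_change phi I.
have liv : slin phi (i \o v) by move=> d x y /=; rewrite lv li.
have [[vT [lvT EvT]] _] := b0.2 _ _ liv.
have lic : slin phi (tin phi (M := I) \o c).
  by move=> d x y /=; rewrite lc (bc_slin bI).
have [[cT [lcT EcT]] _] := hi.2 _ _ lic.
have ljh : slin phi (j \o h) by move=> d x y /=; rewrite lh (bc_slin hj).
have [[hT [lhT EhT]] _] := bI.2 _ _ ljh.
have hTI : injective hT by apply: (fl _ _ h lh hI _ _ _ _ bI hj).
have [Q [e [le _ ev ve]]] := cokernel_exists lvT.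
have lei : slin phi (e \o i) by move=> d x y /=; rewrite li le.
have [u0 [lu0 Eu0]] : exists u0 : I -> Q,
    slin phi u0 /\ forall x, u0 (c x) = e (i x).
  apply: slin_factor => // x /vc [n ->].
  by rewrite -[i _]EvT ev.
have [[u [lu Eu]] _] := bI.2 _ _ lu0.
have luc : lin (u \o cT) by move=> d x y /=; rewrite lcT lu.
have uc x : u (cT x) = e x.
  by apply: (bc_uniq hi luc le) => m; rewrite /= EcT Eu Eu0.
have lhc : lin (hT \o cT) by move=> d x y /=; rewrite lcT lhT.
have hc x : hT (cT x) = gT x.
  by apply: (bc_uniq hi lhc lgT) => m; rewrite /= EcT EhT /= Eh EgT.
have : e p = 0.
  rewrite -uc; suff -> : cT p = 0 by rewrite (lin0 lu).
  by apply: hTI; rewrite hc gp (lin0 lhT).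
move=> /ve [x ->]; have [s ->] := bc_gen b0 x.
exists [seq (y.1, v y.2) | y <- s]; split.
  by move=> _ /mapP [y _ ->]; apply: gv.
rewrite (lin_sum lvT) big_map; apply: eq_bigr => y _.
by rewrite (linZ lvT) EvT.
Qed.

Definition fin_gen (K : pzRingType) (M : lmodType K) :=
  exists (n : nat) (f : 'rV[K]_n -> M), lin f /\ forall x, exists v, f v = x.

Lemma lin_row (K T : pzRingType) (phi : {rmorphism K -> T}) n (M : lmodType T)
    (f : 'rV[K]_n -> M) :
  slin phi f -> forall v, f v = \sum_i phi (v 0 i) *: f (delta_mx 0 i).
Proof.
move=> lf v; rewrite {1}[v]row_sum_delta (slin_sum lf).
by apply: eq_bigr => i _; rewrite (slinZ lf).
Qed.

Lemma row_lin (K : comPzRingType) n (M : lmodType K) (e : 'I_n -> M) :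
  lin (fun v : 'rV[K]_n => \sum_i v 0 i *: e i).
Proof.
move=> c x y; rewrite scaler_sumr -big_split; apply: eq_bigr => i _.
by rewrite !mxE scalerDl scalerA.
Qed.

Lemma row_base_change (K T : comPzRingType) (phi : {rmorphism K -> T}) n :
  is_base_change phi (map_mx phi : 'rV[K]_n -> 'rV[T]_n).
Proof.
split; first by move=> c x y; rewrite map_mxD map_mxZ.
move=> P f lf; split.
  exists (fun v : 'rV[T]_n => \sum_i v 0 i *: f (delta_mx 0 i)).
  split; first exact: row_lin.
  by move=> m; rewrite (lin_row lf); apply: eq_bigr => i _; rewrite mxE.
move=> g1 g2 l1 l2 E x.
rewrite (lin_row (phi := idfun) l1) (lin_row (phi := idfun) l2).
apply: eq_bigr => i _; congr (_ *: _).
by rewrite -(map_delta_mx phi) E.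
Qed.

Lemma fin_gen_bc (K T : comPzRingType) (phi : {rmorphism K -> T})
    (M : lmodType K) (MT : lmodType T) (i : M -> MT) :
  is_base_change phi i -> fin_gen M -> fin_gen MT.
Proof.
move=> hi [n [f [lf fS]]].
have lif : slin phi (i \o f) by move=> c x y /=; rewrite lf (bc_slin hi).
have [[g [lg Eg]] _] := (row_base_change phi n).2 _ _ lif.
exists n, g; split=> //; apply: (bc_ind hi).
  move=> t m x [v <-]; have [u <-] := fS m.
  by exists (t *: map_mx phi u + v); rewrite lg Eg.
by exists 0; rewrite (lin0 lg).
Qed.

Lemma fin_gen_surj (K : pzRingType) (M N : lmodType K) (f : M -> N) :
  lin f -> (forall y, exists x, f x = y) -> fin_gen M -> fin_gen N.
Proof.
move=> lf fS [n [g [lg gS]]]; exists n, (f \o g); split.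
  by move=> c x y /=; rewrite lg lf.
by move=> y; have [x <-] := fS y; have [v <-] := gS x; exists v.
Qed.

(** Generators of [MT] involve only finitely many elements of [M], collected in [b]. Their span
    becomes everything after base change, hence contains each [x] by [faithful_descent_mem]. *)
Lemma fin_gen_descent (K T : comPzRingType) (phi : {rmorphism K -> T})
    (M : lmodType K) (MT : lmodType T) (i : M -> MT) :
  bc_faithful phi -> is_base_change phi i -> fin_gen MT -> fin_gen M.
Proof.
move=> ff hi [n [f [lf fS]]].
have [s Es] := choice (fun j : 'I_n => bc_gen hi (f (delta_mx 0 j))).
pose b := flatten [seq [seq x.2 | x <- s j] | j <- enum 'I_n].
pose h (v : 'rV[K]_(size b)) := \sum_j v 0 j *: b`_j.
have lh : lin h by exact: row_lin.
have hr := row_base_change phi (size b).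
have lih : slin phi (i \o h) by move=> c x y /=; rewrite lh (bc_slin hi).
have [[hT [lhT EhT]] _] := hr.2 _ _ lih.
have hb x : x \in b -> exists v, hT v = i x.
  move=> xb; have lt := xb; rewrite -index_mem in lt.
  exists (map_mx phi (delta_mx 0 (Ordinal lt))); rewrite EhT /= /h.
  rewrite (bigD1 (Ordinal lt)) //= mxE !eqxx scale1r nth_index //.
  rewrite big1 ?addr0 // => j /negPf nj.
  by rewrite mxE nj andbF scale0r.
exists (size b), h; split=> // x.
apply: (faithful_descent_mem ff lh hr hi lhT EhT).
have [w <-] := fS (i x); rewrite (lin_row (phi := idfun) lf w).
have hj j : exists v, hT v = f (delta_mx 0 j).
  rewrite Es.
  (* Only the inclusion in [b] is kept for the induction, since the tails of [s j] are not
     themselves among the lists that make up [b]. *)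
  have: {subset [seq y.2 | y <- s j] <= b}.
    move=> y ys; apply/flattenP; exists [seq y.2 | y <- s j] => //.
    by apply/map_f; rewrite mem_enum.
  elim: (s j) => [|y r IH] sub.
    by exists 0; rewrite big_nil (lin0 lhT).
  have [v Ev] := IH (fun z zr => sub z (mem_behead (s := _ :: _) zr)).
  have [v' Ev'] := hb y.2 (sub y.2 (mem_head _ _)).
  by exists (y.1 *: v' + v); rewrite lhT Ev' Ev big_cons.
have [v Ev] := choice hj; exists (\sum_j w 0 j *: v j).
by rewrite (lin_sum lhT); apply: eq_bigr => j _; rewrite (linZ lhT) Ev.
Qed.

Section Forms.
Variables (K T : comPzRingType) (phi : {rmorphism K -> T}).
Hypothesis fl : bc_flat phi.
Variables (M : lmodType K) (MT : lmodType T) (i : M -> MT).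
Hypothesis hi : is_base_change phi i.
Variables (kappa : M -> M -> K) (kT : MT -> MT -> T).
Hypotheses (hk : bilin_form kappa) (hkT : is_form_base_change phi kappa i kT).

(** Pairing with the generators [e j] embeds [M] in [K^n] by nondegeneracy. Flatness keeps this
    injective, and the base-changed map is the pairing under [kT] with the elements [i (e j)]. *)
Lemma nondegenerate_bc :
  fin_gen M -> nondegenerate_form kappa -> nondegenerate_form kT.
Proof.
move=> [n [f [lf fS]]] nd.
have [kl kr] := hk; have [[Tl Tr] ET] := hkT.
pose e j := f (delta_mx 0 j).
pose g (x : M) := \row_(j < n) kappa x (e j).
pose gT (x : MT) := \row_(j < n) kT x (i (e j)).
have lg : lin g by move=> c x y; apply/rowP => j; rewrite !mxE kr.
have lgT : lin gT by move=> c x y; apply/rowP => j; rewrite !mxE Tr.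
have gI : injective g.
  apply: (lin_inj lg) => x /rowP gx; apply: nd => y; have [v <-] := fS y.
  have lk : lin (kappa x : M -> K^o) by exact: kl.
  rewrite (lin_row (phi := idfun) lf) [LHS](lin_sum lk) big1 // => j _.
  by rewrite (linZ lk); have := gx j; rewrite !mxE => ->; rewrite scaler0.
have EgT x : gT (i x) = map_mx phi (g x).
  by apply/rowP => j; rewrite !mxE ET.
have gTI := fl lg gI hi (row_base_change phi n) lgT EgT.
move=> x kx; apply: gTI; rewrite (lin0 lgT).
by apply/rowP => j; rewrite !mxE kx.
Qed.

(** A functional on [M] is a vector of values on the generators that respects the relations, that
    is, an element of the kernel of [g : K^n -> K^m]. By [flat_kernel] the vector [w] of [L] is a
    [T]-combination of such vectors over [K]; each is represented by nonsingularity of [kappa], and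
    the representing elements are combined with the same coefficients. *)
Lemma nonsingular_bc :
  fin_presented M -> nonsingular_form kappa -> nonsingular_form kT.
Proof.
move=> [n [m [f [rel [lf [fS frel]]]]]] [nd ns].
split; first by apply: nondegenerate_bc => //; exists n, f.
move=> L lL.
have [kl kr] := hk; have [[Tl Tr] ET] := hkT.
pose e j := f (delta_mx 0 j).
have fE v : f v = \sum_j v 0 j *: e j by exact: (lin_row (phi := idfun) lf).
pose g (v : 'rV[K]_n) := \row_(j < m) (\sum_l v 0 l *: (rel j 0 l : K^o)).
pose gT (v : 'rV[T]_n) := \row_(j < m) (\sum_l v 0 l *: (phi (rel j 0 l) : T^o)).
have lg : lin g by move=> c x y; apply/rowP => j; rewrite !mxE row_lin.
have lgT : lin gT by move=> c x y; apply/rowP => j; rewrite !mxE row_lin.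
have EgT v : gT (map_mx phi v) = map_mx phi (g v).
  apply/rowP => j; rewrite !mxE rmorph_sum; apply: eq_bigr => l _.
  by rewrite mxE rmorphM.
have lLo : lin (L : MT -> T^o) by exact: lL.
have Li v : L (i (f v)) = \sum_l phi (v 0 l) * L (i (e l)).
  rewrite fE (slin_sum (bc_slin hi)) [LHS](lin_sum lLo); apply: eq_bigr => l _.
  by rewrite (slinZ (bc_slin hi)) (linZ lLo).
pose w := \row_l L (i (e l)).
have gw : gT w = 0.
  apply/rowP => j; rewrite !mxE.
  have /frel fr : exists c : 'I_m -> K, rel j = \sum_(i < m) c i *: rel i.
    exists (fun l => (l == j)%:R); rewrite (bigD1 j) //= eqxx scale1r.
    by rewrite big1 ?addr0 // => l /negPf ->; rewrite scale0r.
  have := Li (rel j); rewrite fr (slin0 (bc_slin hi)) [L 0](lin0 lLo) => E0.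
  apply: etrans (esym E0).
  by apply: eq_bigr => l _; rewrite !mxE [LHS]mulrC.
have hr p := row_base_change phi p.
have [s [gs Ew]] := flat_kernel fl (hr n) (hr m) lg lgT EgT gw.
(* Orthogonality of [u] to the relations lets the dot product with [u] factor through [f] as a
   functional on [M]. *)
have solve u : g u = 0 -> exists x, forall l, kappa x (e l) = u 0 l.
  move=> gu.
  have [h [lh Eh]] : exists h : M -> K^o, lin h /\
      forall v, h (f v) = \sum_l v 0 l *: (u 0 l : K^o).
    apply: (slin_factor (phi := idfun)) => //; first exact: row_lin.
    move=> v /frel [c ->].
    rewrite (lin_sum (row_lin (fun l => u 0 l : K^o))) big1 // => j _.
    rewrite (linZ (row_lin (fun l => u 0 l : K^o))).
    have /rowP/(_ j) := gu; rewrite !mxE => guj.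
    rewrite [X in _ *: X](_ : _ = 0) ?scaler0 //; apply: etrans guj.
    by apply: eq_bigr => l _; rewrite [LHS]mulrC.
  have [x Ex] := ns h lh; exists x => l; rewrite Ex Eh (bigD1 l) //= big1.
    by rewrite !mxE !eqxx addr0 scale1r.
  by move=> j /negPf nj; rewrite mxE nj andbF scale0r.
have [X EX] : exists X, forall l, kT X (i (e l)) = w 0 l.
  rewrite Ew; elim: s gs {Ew} => [|y r IH] gs.
    exists 0 => l; rewrite big_nil mxE; exact: (lin0 (Tr (i (e l)) : @lin _ _ T^o _)).
  have [|X EX] := IH; first by move=> z zr; apply: gs; rewrite inE zr orbT.
  have [|x Ex] := solve y.2; first by apply: gs; rewrite mem_head.
  by exists (y.1 *: i x + X) => l; rewrite Tr EX ET Ex big_cons !mxE.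
exists X; apply: (bc_uniq hi (Tl X : @lin _ _ T^o _) lLo) => x.
have [v <-] := fS x; rewrite Li fE (slin_sum (bc_slin hi)).
rewrite [LHS](lin_sum (Tl X : @lin _ _ T^o _)); apply: eq_bigr => l _.
rewrite (slinZ (bc_slin hi)) [LHS](linZ (Tl X : @lin _ _ T^o _)) EX mxE.
by [].
Qed.

Lemma invariant_bc mul mulT : is_alg_base_change phi mul i mulT ->
  invariant_form mul kappa -> invariant_form mulT kT.
Proof.
move=> [_ [[ml mr] Em]] inv.
have [[Tl Tr] ET] := hkT.
have o1 z : lin (kT z : MT -> T^o) by exact: Tl.
have o2 z : lin (kT^~ z : MT -> T^o) by exact: Tr.
suff H : forall x y z, kT (mulT x y) z = kT x (mulT y z).
  have C : forall x y z, kT x (mulT y z) = kT y (mulT z x).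
    move=> x y z; move: x y; apply: (bc_suniq2 (q := idfun) (P := T^o) hi).
    - by split=> u c x y; rewrite ?mr ?o1 ?o2.
    - by split=> u c x y; rewrite ?ml ?o1 ?o2.
    move=> x y; move: z; apply: (bc_uniq hi (P := MT) (Q := T^o)).
    - by move=> c u v; rewrite ml o1.
    - by move=> c u v; rewrite mr o1.
    - by move=> z; rewrite !Em !ET; case: (inv x y z) => _ ->.
  by move=> x y z; split.
move=> x y z; move: x y; apply: (bc_suniq2 (q := idfun) (P := T^o) hi).
- by split=> u c x y; rewrite ?ml ?mr ?o1 ?o2.
- by split=> u c x y; rewrite ?ml ?mr ?o1 ?o2.
move=> x y; move: z; apply: (bc_uniq hi (P := MT) (Q := T^o)).
- by move=> c u v; rewrite o1.
- by move=> c u v; rewrite ml o1.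
- by move=> z; rewrite !Em !ET; case: (inv x y z) => ->.
Qed.

End Forms.

(** * Comparison of trivializations *)

Definition alg_of (K T : pzRingType) (psi : K -> T) : Type := T.

Section AlgebraOfMorphism.
Variables (K : comNzRingType) (T : comNzRingType) (psi : {rmorphism K -> T}).
HB.instance Definition _ := GRing.ComNzRing.on (alg_of psi).
HB.instance Definition _ := GRing.Lmodule.copy (alg_of psi) (restr psi T^o).
Let scaleAl (c : K) (x y : alg_of psi) : c *: (x * y) = (c *: x) * y.
Proof. exact: mulrA. Qed.
HB.instance Definition _ := GRing.Lmodule_isLalgebra.Build K (alg_of psi) scaleAl.
HB.instance Definition _ := GRing.Lalgebra_isComAlgebra.Build K (alg_of psi).

(** [aut_invariant] tests algebras through their structure map [r%:A]. Giving [T] the algebra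
    structure [alg_of psi] turns this map into [psi], so any ring morphism between nonzero rings can
    be used. *)
Lemma aut_invariant_bc (C : lmodType K) (mulC : C -> C -> C) (beta : C -> C -> K)
    (CT : lmodType T) (i : C -> CT) mulT betaT (f : CT -> CT) :
  aut_invariant mulC beta -> is_alg_base_change psi mulC i mulT ->
  is_form_base_change psi beta i betaT -> alg_iso mulT mulT f ->
  forall x y, betaT (f x) (f y) = betaT x y.
Proof.
move=> inv hi hb hf.
have E : (fun c : K => c%:A : (alg_of psi : comAlgType K)) = psi.
  by apply/funext => c; exact: mulr1.
by apply: (inv (alg_of psi : comAlgType K) CT i mulT); rewrite ?E.
Qed.
End AlgebraOfMorphism.

Lemma ring_base_change (K T : comPzRingType) (phi : {rmorphism K -> T}) :
  is_base_change phi (phi : K^o -> T^o).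
Proof.
split; first by move=> c x y; rewrite rmorphD rmorphM.
move=> P f lf.
have fE x : f x = phi x *: f 1 by rewrite -(slinZ lf) [x *: _]mulr1.
split.
  exists (fun t : T^o => t *: f 1); split; last by move=> m; rewrite -fE.
  by move=> c x y; rewrite scalerDl -scalerA.
move=> g1 g2 l1 l2 E x.
have gE (g : T^o -> P) : lin g -> g x = x *: g (phi 1 : T^o).
  by move=> lg; rewrite -(linZ lg) rmorph1; congr g; exact/esym/mulr1.
by rewrite !gE // E.
Qed.

(** With [T] in the role of S (x)_K S, the map [q] is the base change of [phi : K -> S], where [S]
    sits in [T] through [q']. From [q s = q' s], the element [q' s] is in the image of [q], and
    [faithful_descent_mem] brings [s] into the image of [phi]. *)
Lemma faithful_descent_ring (K S : comPzRingType) (phi : {rmorphism K -> S})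
    (T : comPzRingType) (q q' : {rmorphism S -> T}) :
  bc_faithful phi -> q \o phi =1 q' \o phi ->
  @is_base_change _ _ phi (restr phi S^o) (restr q T^o) q' ->
  forall s, q s = q' s -> exists r, phi r = s.
Proof.
move=> ff E hT s es.
apply: (@faithful_descent_mem _ _ _ ff K^o (restr phi S^o) phi S^o (restr q T^o)
  phi q' q _ (ring_base_change phi) hT).
- by move=> c x y; rewrite rmorphD rmorphM.
- by move=> c x y; rewrite rmorphD rmorphM.
- exact: E.
- by exists s.
Qed.

(** This moves trivializations to a common ring, where they can be compared: form values computed
    through [theta] are carried by [q] to those computed through its extension. *)
Lemma trivialization_bc (K R S T : comPzRingType) (eta : {rmorphism K -> R})
    (p : {rmorphism R -> S}) (q : {rmorphism S -> T}) (r : {rmorphism R -> T})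
    (a : lmodType K) amul (kappa : a -> a -> K) (B : lmodType R) bmul
    (BS : lmodType S) (iS : B -> BS) bS (aS : lmodType S) (jS : a -> aS) mS muS
    (BT : lmodType T) (iT : B -> BT) bT (aT : lmodType T) (jT : a -> aT) mT muT
    (theta : BS -> aS) :
  r =1 q \o p ->
  is_alg_base_change p bmul iS bS -> is_alg_base_change (p \o eta) amul jS mS ->
  is_alg_base_change r bmul iT bT -> is_alg_base_change (r \o eta) amul jT mT ->
  is_form_base_change (p \o eta) kappa jS muS ->
  is_form_base_change (r \o eta) kappa jT muT ->
  alg_iso bS mS theta ->
  exists thetaT, alg_iso bT mT thetaT /\ forall x y,
    muT (thetaT (iT x)) (thetaT (iT y)) = q (muS (theta (iS x)) (theta (iS y))).
Proof.
move=> E hB ha hBT haT hk hkT ht.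
have Ea : r \o eta =1 q \o (p \o eta) by move=> c /=; rewrite E.
have [w [lw Ew]] := bc_lift E hB.1 (bc_slin hBT.1).
have [v [lv Ev]] := bc_lift Ea ha.1 (bc_slin haT.1).
have [thT [hthT EthT]] := alg_iso_bc (alg_bc_trans E hB.1 lw Ew hB hBT)
  (alg_bc_trans Ea ha.1 lv Ev ha haT) ht.
exists thT; split=> // x y; rewrite -!Ew !EthT.
exact: (form_bc_compat Ea ha.1 lv Ev hk hkT).
Qed.

(* Two trivializations over [S1] and [S2] differ over [T] by an automorphism of
   [a (x) T], which preserves the base change of [kappa]. *)
Lemma trivialization_indep (K : comNzRingType) (R S1 S2 : comPzRingType)
    (T : comNzRingType) (eta : {rmorphism K -> R})
    (p1 : {rmorphism R -> S1}) (p2 : {rmorphism R -> S2})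
    (q1 : {rmorphism S1 -> T}) (q2 : {rmorphism S2 -> T})
    (a : lmodType K) amul (kappa : a -> a -> K) (B : lmodType R) bmul
    (B1 : lmodType S1) (i1 : B -> B1) b1 (a1 : lmodType S1) (j1 : a -> a1) m1 mu1
    (B2 : lmodType S2) (i2 : B -> B2) b2 (a2 : lmodType S2) (j2 : a -> a2) m2 mu2
    (theta1 : B1 -> a1) (theta2 : B2 -> a2) :
  bilin_op amul -> bilin_op bmul -> bilin_form kappa -> aut_invariant amul kappa ->
  q1 \o p1 =1 q2 \o p2 ->
  is_alg_base_change p1 bmul i1 b1 -> is_alg_base_change (p1 \o eta) amul j1 m1 ->
  is_form_base_change (p1 \o eta) kappa j1 mu1 -> alg_iso b1 m1 theta1 ->
  is_alg_base_change p2 bmul i2 b2 -> is_alg_base_change (p2 \o eta) amul j2 m2 ->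
  is_form_base_change (p2 \o eta) kappa j2 mu2 -> alg_iso b2 m2 theta2 ->
  forall x y, q1 (mu1 (theta1 (i1 x)) (theta1 (i1 y))) =
              q2 (mu2 (theta2 (i2 x)) (theta2 (i2 y))).
Proof.
move=> ham hbm hk hinv E hB1 ha1 hk1 ht1 hB2 ha2 hk2 ht2 x y.
have [BT [iT [bT hBT]]] := alg_bc_exists (q1 \o p1) hbm.
have [aT [jT [mT haT]]] := alg_bc_exists ((q1 \o p1) \o eta) ham.
have [muT hkT] := form_bc_exists haT.1 hk.
have [t1 [ht1' E1]] := trivialization_bc (fun=> erefl) hB1 ha1 hBT haT hk1 hkT ht1.
have [t2 [ht2' E2]] := trivialization_bc E hB2 ha2 hBT haT hk2 hkT ht2.
rewrite -E1 -E2; have [t2' [ht2i t2K _]] := alg_iso_inv ht2'.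
have := aut_invariant_bc hinv haT hkT (alg_iso_comp ht2i ht1') (t2 (iT x)) (t2 (iT y)).
by rewrite /= !t2K.
Qed.

(** * Construction of the descended form and descent of its properties *)

Theorem theorem5p4 (k : comNzRingType) (a : lmodType k) (amul : a -> a -> a)
  (R : comAlgType k) (S : comAlgType R) (B : lmodType R) (bmul : B -> B -> B)
  (kappa : a -> a -> k) :
  bilin_op amul -> bilin_op bmul ->
  flat (R : lmodType k) ->
  faithfully_flat (S : lmodType R) ->
  (* B is an S/R-form of a (x)_k R *)
  (exists (BS : lmodType S) (iB : B -> BS) (mBS : BS -> BS -> BS)
          (aS : lmodType S) (ia : a -> aS) (maS : aS -> aS -> aS)
          (theta : BS -> aS),
     is_alg_base_change (fun r : R => r%:A : S) bmul iB mBS /\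
     is_alg_base_change (fun c : k => (c%:A : R)%:A : S) amul ia maS /\
     alg_iso mBS maS theta) ->
  bilin_form kappa -> aut_invariant amul kappa ->
  let charac (kB : B -> B -> R) :=
    forall (S' : comAlgType R), faithfully_flat (S' : lmodType R) ->
    forall (BS' : lmodType S') (iB : B -> BS') (mB : BS' -> BS' -> BS')
           (aS' : lmodType S') (ia : a -> aS') (ma : aS' -> aS' -> aS'),
    is_alg_base_change (fun r : R => r%:A : S') bmul iB mB ->
    is_alg_base_change (fun c : k => (c%:A : R)%:A : S') amul ia ma ->
    forall theta : BS' -> aS', alg_iso mB ma theta ->
    forall (lam : BS' -> BS' -> S') (mu : aS' -> aS' -> S'),
    is_form_base_change (fun r : R => r%:A : S') kB iB lam ->
    is_form_base_change (fun c : k => (c%:A : R)%:A : S') kappa ia mu ->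
    forall x y, lam x y = mu (theta x) (theta y) in
  exists kB : B -> B -> R,
    [/\ (* (a) existence and uniqueness *)
        bilin_form kB /\ charac kB,
        (forall kB' : B -> B -> R, bilin_form kB' -> charac kB' ->
           forall x y, kB' x y = kB x y),
        (* (a) Aut(B)-invariance *)
        aut_invariant bmul kB,
        (* (b) *)
        (invariant_form amul kappa -> invariant_form bmul kB) &
        (* (c) *)
        (fin_presented a ->
           (nondegenerate_form kappa -> nondegenerate_form kB) /\
           (nonsingular_form kappa -> nonsingular_form kB))].
Proof.
move=> ham hbm flR ffS0.
move=> [BS [iB [mBS [aS [ia [maS [theta [hB [ha ht]]]]]]]]] hk hinv charac.
pose eta : {rmorphism k -> R} := GRing.in_alg R.
pose p : {rmorphism R -> S} := GRing.in_alg S.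
(* The structure maps [r%:A] are convertible to ring morphisms; the hypotheses are restated with the
   latter. *)
have {}hB : is_alg_base_change p bmul iB mBS by exact: hB.
have {}ha : is_alg_base_change (p \o eta) amul ia maS by exact: ha.
have ffS : bc_faithful p by exact: faithfully_flat_bc ffS0.
have [mu hmu] := form_bc_exists ha.1 hk.
have lB := bc_slin hB.1.
have [lt [_ mt]] := ht.
have [theta' [ht' tK t'K]] := alg_iso_inv ht.
have lt' := ht'.1.
have [[mul mur] Emu] := hmu.
have pI : injective p.
  apply: (slin_inj (f := p : R^o -> S^o) (bc_slin (ring_base_change p))).
  exact: (faithful_inj ffS (ring_base_change p)).
(* Here [T] is S (x)_R S with its two coprojections. Independence with [theta] on both sides shows
   that [q] and [q'] agree on the value. *)
have desc (z : B * B) : exists r, p r = mu (theta (iB z.1)) (theta (iB z.2)).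
  have [T [q [q' [E hT]]]] := tensor_ring p ffS.
  apply: (faithful_descent_ring ffS E hT).
  exact: (trivialization_indep ham hbm hk hinv E hB ha hmu ht hB ha hmu ht).
have [kB0 EkB0] := choice desc; pose kB x y := kB0 (x, y).
have EkB x y : p (kB x y) = mu (theta (iB x)) (theta (iB y)) := EkB0 (x, y).
have bkB : bilin_form kB.
  by split=> z c x y; apply: pI; rewrite rmorphD rmorphM !EkB lB lt ?mul ?mur.
have ckB : charac kB.
  move=> S' ffS'0 B' iB' mB' a' ia' ma' hB'0 ha'0 th' hth' lam mu' hlam0 hmu'0.
  pose p' : {rmorphism R -> S'} := GRing.in_alg S'.
  have hB' : is_alg_base_change p' bmul iB' mB' by exact: hB'0.
  have ha' : is_alg_base_change (p' \o eta) amul ia' ma' by exact: ha'0.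
  have hmu' : is_form_base_change (p' \o eta) kappa ia' mu' by exact: hmu'0.
  have [[laml lamr] Elam] : is_form_base_change p' kB iB' lam by exact: hlam0.
  (* The two trivializations are compared over S (x)_R S', into which [S'] embeds because [S] is
     faithfully flat over [R]. *)
  have [T [q [q' [E hT]]]] := tensor_ring p' ffS.
  have q'I : injective q'.
    apply: (slin_inj (bc_slin hT)); exact: (faithful_inj ffS hT).
  have [[mul' mur'] _] := hmu'.
  apply: (bc_suniq2 (q := idfun) (P := S'^o) hB'.1).
  - by split=> z c x y; rewrite ?laml ?lamr.
  - by split=> z c x y; rewrite hth'.1 ?mul' ?mur'.
  move=> x y; rewrite Elam; apply: q'I.
  rewrite -(trivialization_indep ham hbm hk hinv E hB ha hmu ht hB' ha' hmu' hth').
  by rewrite -EkB; exact/esym/E.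
have hlam : is_form_base_change p kB iB (fun x y => mu (theta x) (theta y)).
  split; last by move=> x y; rewrite EkB.
  by split=> z c x y; rewrite lt ?mul ?mur.
exists kB; split=> //.
(* As [p] is injective, the characterization at [S' = S] with the given [theta] already determines
   the form. *)
- move=> kB' bkB' ckB' x y; apply: pI; rewrite EkB.
  have [lam hlam'] := form_bc_exists hB.1 bkB'.
  rewrite -[LHS](hlam'.2).
  exact: (ckB' S ffS0 _ _ _ _ _ _ hB ha _ ht _ _ hlam' hmu).
- move=> T BT iT mT hBT0 betaT hbT0 f hf.
  pose r : {rmorphism R -> T} := GRing.in_alg T.
  have hBT : is_alg_base_change r bmul iT mT by exact: hBT0.
  have hbT : is_form_base_change r kB iT betaT by exact: hbT0.
  (* Over U = S (x)_R T the extension [th] of [theta] trivializes [B] and conjugates the extension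
     of [f] into an automorphism of a (x)_k U, which preserves [muU]. Since [T] embeds in [U], the
     identity descends. *)
  have [U [q [q' [E hU]]]] := tensor_ring r ffS.
  have q'I : injective q'.
    apply: (slin_inj (bc_slin hU)); exact: (faithful_inj ffS hU).
  have [BU [iU [mU hBU]]] := alg_bc_exists (q \o p) hbm.
  have [aU [jU [nU haU]]] := alg_bc_exists ((q \o p) \o eta) ham.
  have [muU hkU] := form_bc_exists haU.1 hk.
  have [th [hth Eth]] := trivialization_bc (fun=> erefl) hB ha hBU haU hmu hkU ht.
  have [w [lw Ew]] := bc_lift E hBT.1 (bc_slin hBU.1).
  have hBTU := alg_bc_trans E hBT.1 lw Ew hBT hBU.
  have [fU [hfU EfU]] := alg_iso_bc hBTU hBTU hf.
  have hbU : is_form_base_change (q \o p) kB iU (fun x y => muU (th x) (th y)).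
    have [[mUl mUr] _] := hkU; split; last by move=> x y; rewrite Eth -EkB.
    by split=> z c x y; rewrite hth.1 ?mUl ?mUr.
  have wE := form_bc_compat E hBT.1 lw Ew hbT hbU.
  have [th' [hth' thK _]] := alg_iso_inv hth.
  move=> x y; apply: q'I; rewrite -!wE -!EfU.
  have := aut_invariant_bc hinv haU hkU
    (alg_iso_comp hth' (alg_iso_comp hfU hth)) (th (w x)) (th (w y)).
  by rewrite /= !thK.
- move=> inv x y z.
  have := invariant_bc ha.1 hmu ha inv (theta (iB x)) (theta (iB y)) (theta (iB z)).
  by rewrite -!mt !hB.2.2 -!EkB => -[/pI -> /pI ->].
move=> fp.
(* [S] is flat over [k] through [R], so nondegeneracy and nonsingularity pass from [kappa] to
   [mu]. *)
have fla : bc_flat (p \o eta).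
  by apply: (bc_flat_comp (fun=> erefl) (flat_bc flR) ffS.1).
have fga : fin_gen a.
  by have [n [m [f [rel [lf [fS _]]]]]] := fp; exists n, f.
(* If [x] is orthogonal to [B], then [theta (iB x)] is orthogonal to all of [aS], since the image of
   [iB] generates [BS]; and both [iB] and [theta] are injective. *)
have ndB : nondegenerate_form mu -> nondegenerate_form kB.
  move=> nd x kx; apply: (faithful_inj ffS hB.1); apply: (can_inj tK).
  rewrite (lin0 lt); apply: nd => y; rewrite -[y]t'K.
  have l1 : lin (fun Y => mu (theta (iB x)) (theta Y) : S^o).
    by move=> c u v; rewrite lt mul.
  have l0 : lin (fun _ : BS => 0 : S^o) by move=> c u v; rewrite scaler0 addr0.
  apply: (bc_uniq hB.1 l1 l0) => m; rewrite -EkB kx; exact: rmorph0.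
split=> [nd|ns]; first by apply/ndB/(nondegenerate_bc fla ha.1 hk hmu).
have [ndmu nsmu] := nonsingular_bc fla ha.1 hk hmu fp ns.
split; first exact: ndB.
move=> l ll; have ll' : lin (l : B -> R^o) by exact: ll.
(* Extended to [BS] and transported to [aS], the functional [l] is represented by [X]; so [theta' X]
   represents it, but only in [BS]. *)
have lpl : slin p (fun x => p (l x) : S^o).
  by move=> c x y; rewrite ll rmorphD rmorphM.
have [[lS [llS ElS]] _] := hB.1.2 _ _ lpl.
have [|X EX] := nsmu (lS \o theta'); first by move=> c x y /=; rewrite lt' llS.
have [n [F [lF FS]]] : fin_gen B.
  apply: (fin_gen_descent ffS hB.1).
  apply: (fin_gen_surj lt' _ (fin_gen_bc ha.1 fga)) => y.
  by exists (theta y); rewrite tK.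
(* Evaluation on generators of [B] turns representing [l] into membership of the row of values
   [l (e j)] in the image of [g]. The element [theta' X] gives membership after base change, and
   this descends. *)
pose e j := F (delta_mx 0 j).
pose g (x : B) := \row_(j < n) kB x (e j).
pose gS (x : BS) := \row_(j < n) mu (theta x) (theta (iB (e j))).
have lg : lin g by move=> c x y; apply/rowP => j; rewrite !mxE bkB.2.
have lgS : lin gS by move=> c x y; apply/rowP => j; rewrite !mxE lt mur.
have EgS x : gS (iB x) = map_mx p (g x).
  by apply/rowP => j; rewrite !mxE EkB.
have [|x /rowP Ex] := faithful_descent_mem ffS lg hB.1 (row_base_change p n) lgS EgS
  (n := \row_j l (e j)).
  exists (theta' X); apply/rowP => j.
  by rewrite !mxE t'K EX /= tK ElS.
exists x => y; have [v <-] := FS y.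
have lk : lin (kB x : B -> R^o) by exact: bkB.1.
rewrite (lin_row (phi := idfun) lF) [LHS](lin_sum lk) [RHS](lin_sum ll').
apply: eq_bigr => j _; rewrite (linZ lk) (linZ ll').
by have := Ex j; rewrite !mxE => ->.
Qed.
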